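(* Let $d\ge 2$, $t\ge 2$, $n\ge 5$ be integers with $n\ge 2t$. Define $S\subseteq\mathcal A_d^n$ as the union of $$\{x\in\mathcal A_d^n : \text{for some } m\in\mathcal A_d \text{ and some integer } 1\le \ell\le t,\ x^{(t,m)}(t+1-\ell:n-1)\text{ is } \ell\text{-periodic, but } x^{(t,m)}(t+1-\ell:n-1)\oplus (x_n+m)\text{ is not } \ell\text{-periodic}\}$$ and $$\{x\in\mathcal A_d^n : x_t\ne x_n \text{ and } x^{(t,m)}(t+1-\ell:n-1)\text{ is not } \ell\text{-periodic for any } m\in\mathcal A_d \text{ and any integer } 1\le\ell\le t\}.$$ Then $S$ is a $t$-identifying code of $\vec{\mathcal B}(d,n)$ of size $d^{n-1}(d-1)$, and no $t$-identifying code of $\vec{\mathcal B}(d,n)$ has fewer vertices.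
   Context: $\mathcal A_d=\{0,1,\dots,d-1\}$; $\mathcal A_d^n$ is the set of strings $x=x_1\cdots x_n$ over $\mathcal A_d$; letter sums such as $x_n+m$ are taken modulo $d$. The directed de Bruijn graph $\vec{\mathcal B}(d,n)$ has vertex set $\mathcal A_d^n$ and an arc from $x_1\cdots x_n$ to $y_1\cdots y_n$ iff $x_2\cdots x_n=y_1\cdots y_{n-1}$. $\vec d(u,v)$ is the length of a shortest directed walk from $u$ to $v$; $B_t^-(v)=\{u:\vec d(u,v)\le t\}$; for $S\subseteq V$, $\mathrm{ID}_S(v)=B_t^-(v)\cap S$; a $t$-identifying code is a set $S$ with $\mathrm{ID}_S(v)\ne\emptyset$ for all $v$ and $\mathrm{ID}_S(u)\ne\mathrm{ID}_S(v)$ for all $u\ne v$. String notation: $x(a:b)=x_ax_{a+1}\cdots x_b$; $\oplus$ denotes concatenation (a single letter is a string of length 1). For $w\in\mathcal A_d^n$, a position $t$ and $m\in\mathcal A_d$, $w^{(t,m)}$ is the string obtained from $w$ by replacing $w_t$ by $(w_t+m)\bmod d$ and leaving all other letters unchanged. A string $w$ of length $L$ has period length $\ell$ (a positive integer) if $L\ge 2\ell$ and $w_i=w_{i+\ell}$ for all $1\le i\le L-\ell$; $w$ is $\ell$-periodic if it has period length $\ell$ and has no period length $k$ with $k<\ell$. *)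

(* Defs.v *)
From mathcomp Require Import all_boot all_order all_algebra.

Set Implicit Arguments.
Unset Strict Implicit.
Unset Printing Implicit Defensive.

Section Digraph.
Variables (V : finType) (e : rel V).

Definition has_walk (k : nat) (u v : V) : bool :=
  [exists p : k.-tuple V, path e u p && (last u p == v)].

(* The distance is a relation because it is undefined when v is not reachable
   from u. *)
Definition is_dist (u v : V) (k : nat) : bool :=
  has_walk k u v && [forall j : 'I_k, ~~ has_walk j u v].

Definition in_ball (t : nat) (v : V) : {set V} :=
  [set u | [exists k : 'I_t.+1, is_dist u v k]].

Definition ID (t : nat) (S : {set V}) (v : V) : {set V} := in_ball t v :&: S.

Definition identifying_code (t : nat) (S : {set V}) : Prop :=
  (forall v, ID t S v <> set0) /\
  (forall u v, u <> v -> ID t S u <> ID t S v).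

End Digraph.

(* Positions in strings are counted from 1; the functions below are only
   meaningful at positions i with 1 <= i <= size w. *)

Definition substr (T : Type) (w : seq T) (a b : nat) : seq T :=
  drop a.-1 (take b w).

Definition has_period (T : eqType) (w : seq T) (l : nat) : bool :=
  [&& 0 < l, 2 * l <= size w &
      [forall i : 'I_(size w - l), onth w i == onth w (i + l)]].

Definition periodic (T : eqType) (l : nat) (w : seq T) : bool :=
  has_period w l && [forall k : 'I_l, ~~ has_period w k].

(* The alphabet {0, ..., d-1} with addition modulo d is 'Z_d, for d >= 2. *)

Definition letter (d : nat) (w : seq 'Z_d) (i : nat) : 'Z_d :=
  nth 0%R w i.-1.

(* The string written w^(i,m) on paper. *)
Definition shift_letter (d : nat) (w : seq 'Z_d) (i : nat) (m : 'Z_d) :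
    seq 'Z_d :=
  set_nth 0%R w i.-1 (letter w i + m)%R.

Definition deBruijn (d n : nat) : rel (n.-tuple 'Z_d) :=
  fun x y => substr x 2 n == substr y 1 (n - 1).

(* x^(t,m)(t+1-l : n-1) *)
Definition window (d n t : nat) (x : n.-tuple 'Z_d) (m : 'Z_d) (l : nat) :
    seq 'Z_d :=
  substr (shift_letter x t m) (t + 1 - l) (n - 1).

Definition code_periodic (d n t : nat) : {set n.-tuple 'Z_d} :=
  [set x : n.-tuple 'Z_d | [exists m : 'Z_d, exists l : 'I_t.+1,
     [&& 1 <= l, periodic l (window t x m l) &
         ~~ periodic l (window t x m l ++ [:: (letter x n + m)%R])]]].

Definition code_aperiodic (d n t : nat) : {set n.-tuple 'Z_d} :=
  [set x : n.-tuple 'Z_d | (letter x t != letter x n) &&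
     [forall m : 'Z_d, forall l : 'I_t.+1,
        (1 <= l) ==> ~~ periodic l (window t x m l)]].

Definition code (d n t : nat) : {set n.-tuple 'Z_d} :=
  code_periodic d n t :|: code_aperiodic d n t.

(* Main.v *)
Require Import Defs.
From mathcomp Require Import all_boot all_order all_algebra.
From mathcomp Require Import zify.

Set Implicit Arguments.
Unset Strict Implicit.
Unset Printing Implicit Defensive.

Import GRing.Theory.

(** Membership of a word x in the code depends only on x_n - x_t and on the
letters at the other positions: x is a codeword iff x_n - x_t differs from an
offset computed from those letters. The offset is well defined by a Fine-Wilf
argument: all periods of the window x(t+1-l : n-1) that are possible after
changing x_t predict the same letters at positions t and n. Hence every word of
length n-1 has exactly one extension by a last letter outside the code, which
gives the size. Two words with a common prefix of length n-1 have the same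
in-neighbours, so any t-identifying code misses at most one of them, which gives
optimality.

To separate u from v, let D be the first position where they differ. If
D > n - t, prepend to u(1:D) and v(1:D) copies of a letter distinct from v_1;
one of the two words is a codeword, and it lies in only one of the two balls,
because a word that is periodic from around t up to n is never a codeword. If
D <= n - t, words w u(1:n-t) with the first t-1 letters of w distinct from v_1
force u(1:n-t) = v(2:n-t+1), and symmetrically; then u and v begin with baba...
and abab..., and b...b c u(1:n-t) with c <> a is a codeword separating them. *)

Definition period_between (T : Type) (z : nat -> T) (a b p : nat) : Prop :=
  forall i, a <= i -> i + p <= b -> z i = z (i + p).

Lemma fine_wilf (T : Type) (z : nat -> T) (a p q : nat) :
    0 < p -> 0 < q ->
    period_between z a.+1 (a + p + q).-1 p ->
    period_between z a.+1 (a + p + q).-1 q ->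
  z (a + p) = z (a + q).
Proof.
have [N] := ubnP (p + q); elim: N p q => // N IH p q pqN p0 q0 zp zq.
(* One step of the Euclidean algorithm on the periods. *)
have reduce p' q' : p' < q' -> p' + q' <= N -> 0 < p' ->
    period_between z a.+1 (a + p' + q').-1 p' ->
    period_between z a.+1 (a + p' + q').-1 q' -> z (a + p') = z (a + q').
  move=> pq' pqN' p0' zp' zq'.
  have -> : z (a + p') = z (a + (q' - p')).
    apply: IH => [|//||i hi hi'|i hi hi']; try lia.
      by apply: zp'; lia.
    by rewrite zq' 1?[RHS]zp'; [congr z|..]; lia.
  by rewrite zp'; [congr z|..]; lia.
have [pq|qp|->//] := ltngtP p q; first by apply: reduce => //; lia.
by apply/esym/reduce; rewrite // 1?addnAC //; lia.
Qed.

Section Offset.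
Variables (V : zmodType) (n t : nat).
Implicit Types X Y : nat -> V.

(* [X] has period [l] on [t+1-l .. n-1], except that the equation
   [X t = X (t+l)], the only one involving [X t], is not required. *)
Definition punctured_period X l : bool :=
  [&& 0 < l, l <= t, t + l < n &
      [forall i : 'I_n, (t < i + l < n) && (i != t :> nat) ==>
         (X i == X (i + l))]].

Lemma punctured_periodP X l :
  reflect [/\ 0 < l, l <= t, t + l < n &
             forall i, t < i + l < n -> i != t -> X i = X (i + l)]
          (punctured_period X l).
Proof.
apply: (iffP and4P) => -[l0 lt tln Xl]; split=> //.
  move=> i il it; have i_lt_n : i < n by lia.
  by have /forallP/(_ (Ordinal i_lt_n)) := Xl; rewrite /= il it => /eqP.
by apply/forallP => i; apply/implyP => /andP[il it]; apply/eqP/Xl.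
Qed.

Lemma eq_punctured_period X Y l :
    (forall i, 0 < i < n -> i != t -> X i = Y i) ->
  punctured_period X l = punctured_period Y l.
Proof.
move=> XY; apply/punctured_periodP/punctured_periodP => -[l0 lt tln Xl].
  by split=> // i il it; rewrite -!XY; [apply: Xl|..]; lia.
by split=> // i il it; rewrite !XY; [apply: Xl|..]; lia.
Qed.

(* Both [l] and [k - l] are periods of [X] on [t+1 .. t+k-1]. *)
Lemma punctured_period_fine_wilf X l k :
    punctured_period X l -> l < k -> t + k <= n ->
    (forall i, t < i + l -> i < t -> X i = X (i + k)) ->
  X (t + l) = X (t + (k - l)).
Proof.
move=> /punctured_periodP[l0 lt tln Xl] lk tkn Xk.
apply: fine_wilf => [//||i ti ik|i ti ik]; first lia; first by apply: Xl; lia.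
have -> : X i = X (i - l) by rewrite [RHS]Xl; [congr X|..]; lia.
by rewrite Xk; [congr X|..]; lia.
Qed.

Lemma punctured_period_unique_lt X l k : l < k ->
    punctured_period X l -> punctured_period X k ->
  X (t + l) = X (t + k) /\ X (n - l) = X (n - k).
Proof.
move=> lk Xl /punctured_periodP[k0 kt tkn Xk].
have XtlE : X (t + l) = X (t + (k - l)).
  by apply: punctured_period_fine_wilf => // [|i ti it]; [|apply: Xk]; lia.
have /punctured_periodP[l0 lt tln {}Xl] := Xl.
have XtE : X (t + l) = X (t + k) by rewrite XtlE Xl; [congr X|..]; lia.
split=> //; have [nklt|nklt] := eqVneq (n - k - l) t.
  have -> : n - l = t + k by lia.
  by have -> : n - k = t + l by lia.
have -> : X (n - k) = X (n - k - l) by rewrite [RHS]Xl; [congr X|..]; lia.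
by rewrite [RHS]Xk; [congr X|..]; lia.
Qed.

Lemma punctured_period_unique X l k :
    punctured_period X l -> punctured_period X k ->
  X (t + l) = X (t + k) /\ X (n - l) = X (n - k).
Proof.
have [lk|kl|-> //] := ltngtP l k; first exact: punctured_period_unique_lt.
by move=> Xl Xk; have [-> ->] := punctured_period_unique_lt kl Xk Xl.
Qed.

(* The difference [X n - X t] forced by the requirement that a punctured period
   become a period of [X] on [t+1-l .. n]. *)
Definition offset X : V :=
  if [pick l : 'I_t.+1 | punctured_period X l] is Some l
  then (X (n - l)%N - X (t + l)%N)%R else 0%R.

Variant offset_spec X : V -> Prop :=
  | OffsetPeriod l of punctured_period X l :
      offset_spec X (X (n - l)%N - X (t + l)%N)%R
  | OffsetNoPeriod of (forall l, ~~ punctured_period X l) : offset_spec X 0%R.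

Lemma offsetP X : offset_spec X (offset X).
Proof.
rewrite /offset; case: pickP => [l|noX]; first exact: OffsetPeriod.
apply: OffsetNoPeriod => l; apply/negP => Xl.
have /punctured_periodP[_ lt _ _] := Xl.
by have := noX (Ordinal (lt : l < t.+1)); rewrite Xl.
Qed.

Lemma offsetE X l :
  punctured_period X l -> offset X = (X (n - l)%N - X (t + l)%N)%R.
Proof.
move=> Xl; case: offsetP => [k Xk|/(_ l)]; last by rewrite Xl.
by have [-> ->] := punctured_period_unique Xl Xk.
Qed.

Lemma eq_offset X Y :
  (forall i, 0 < i < n -> i != t -> X i = Y i) -> offset X = offset Y.
Proof.
move=> XY; case: (offsetP Y) => [l Yl|noY].
  have /punctured_periodP[l0 lt tln _] := Yl.
  by rewrite (@offsetE X l) ?(eq_punctured_period _ XY) // !XY //; lia.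
by case: offsetP => // l; rewrite (eq_punctured_period _ XY) (negPf (noY l)).
Qed.

Lemma offset_period X p : 2 * t <= n -> 0 < p <= t ->
  period_between X (t - p).+1 n p -> offset X = (X n - X t)%R.
Proof.
move=> tn p0t Xp; have [tpn|npt] := ltnP (t + p) n.
  rewrite (@offsetE _ p); last first.
    by apply/punctured_periodP; split=> // [||i ip _]; [..|apply: Xp]; lia.
  by rewrite -Xp ?[X (n - p)]Xp ?subnK //; lia.
have XnE : X n = X t by rewrite [RHS]Xp; [congr X|..]; lia.
rewrite XnE subrr; case: offsetP => // l Xl.
have /punctured_periodP[l0 lt tln _] := Xl.
have -> : n - l = t + (p - l) by lia.
apply/eqP; rewrite subr_eq0 eq_sym; apply/eqP.
by apply: punctured_period_fine_wilf => // [||i ti it]; [..|apply: Xp]; lia.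
Qed.

End Offset.

Section Substrings.
Variable d : nat.
Implicit Types w : seq 'Z_d.

Lemma size_shift_letter w i m :
  0 < i <= size w -> size (shift_letter w i m) = size w.
Proof. by move=> iw; rewrite size_set_nth; lia. Qed.

Lemma letter_shift_letter w i m j : 0 < i -> 0 < j ->
  letter (shift_letter w i m) j = (letter w j + (if j == i then m else 0))%R.
Proof.
case: i j => [//|i] [//|j] _ _.
rewrite /letter /shift_letter nth_set_nth /= eqSS.
by case: eqP => [->|]; rewrite ?addr0.
Qed.

Lemma substr_shift_letter w i m a b : b < i <= size w ->
  substr (shift_letter w i m) a b = substr w a b.
Proof.
move=> /andP[bi iw]; have i1w : i.-1 < size w by lia.
rewrite /substr /shift_letter set_nthE i1w.
by rewrite takel_cat ?size_takel ?take_takel //; lia.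
Qed.

Lemma substrS w a b : 0 < a <= b.+1 -> b < size w ->
  substr w a b.+1 = rcons (substr w a b) (letter w b.+1).
Proof.
move=> ab bw.
by rewrite /substr (take_nth 0%R) // drop_rcons // size_takel; lia.
Qed.

Lemma size_substr w a b : 0 < a -> b <= size w ->
  size (substr w a b) = b.+1 - a.
Proof. by move=> a0 bw; rewrite size_drop size_takel //; lia. Qed.

Lemma nth_substr w a b i : 0 < a -> a + i <= b ->
  nth 0%R (substr w a b) i = letter w (a + i).
Proof.
move=> a0 ab; rewrite nth_drop nth_take; last lia.
by congr (nth _ _ _); lia.
Qed.

Lemma has_period_substrP w a b l : 0 < a -> b <= size w ->
  reflect [/\ 0 < l, a + 2 * l <= b.+1 & period_between (letter w) a b l]
          (has_period (substr w a b) l).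
Proof.
move=> a0 bw; rewrite /has_period size_substr //.
have onth_substr i :
    a + i <= b -> onth (substr w a b) i = Some (letter w (a + i)).
  by move=> ai; rewrite onthE (nth_map 0%R) ?size_substr ?nth_substr //; lia.
apply: (iffP and3P) => -[l0 lab per]; split=> //; first lia.
- move=> i ai ib; have il : i - a < b.+1 - a - l by lia.
  have /forallP/(_ (Ordinal il))/eqP := per.
  rewrite /= !onth_substr; [|lia..] => -[].
  have -> : a + (i - a) = i by lia.
  by have -> : a + (i - a + l) = i + l by lia.
- lia.
- apply/forallP => -[i il] /=; rewrite !onth_substr; [|lia..].
  by rewrite addnA -per //; lia.
Qed.

Lemma has_period_substrW w a a' b b' l :
    0 < a <= a' -> b' <= b <= size w -> a' + 2 * l <= b'.+1 ->
  has_period (substr w a b) l -> has_period (substr w a' b') l.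
Proof.
move=> aa' b'b abl /has_period_substrP[||l0 _ per]; [lia..|].
by apply/has_period_substrP; [lia..|split=> // i ai ib; apply: per; lia].
Qed.

Lemma periodic_substrS w a b l :
    0 < a -> b < size w -> periodic l (substr w a b) ->
  periodic l (substr w a b.+1) = (letter w b.+1 == letter w (b.+1 - l)).
Proof.
move=> a0 bw /andP[/(has_period_substrP l a0 (ltnW bw))[l0 abl perl]].
move=> /forallP minl.
apply/andP/eqP => [[/(has_period_substrP l a0 bw)[_ _ perlS] _]|lbE].
  by rewrite [RHS]perlS; [congr letter|..]; lia.
split.
  apply/has_period_substrP; [lia..|split=> // [|i ai]; first lia].
  rewrite leq_eqVlt => /predU1P[ib|ib]; last by apply: perl; lia.
  by rewrite ib lbE; congr letter; lia.
apply/forallP => k; have kl := ltn_ord k.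
by apply: contra (minl k); apply: has_period_substrW; lia.
Qed.

End Substrings.

Section Membership.
Variables (d n t : nat).
Hypotheses (t0 : 0 < t) (tn : t < n).
Implicit Types x : n.-tuple 'Z_d.

Local Notation offset_of x := (offset n t (letter x)).

Definition shift_both x (m : 'Z_d) : seq 'Z_d :=
  shift_letter (shift_letter x t m) n m.

Lemma size_shift_both x m : size (shift_both x m) = n.
Proof. by rewrite !size_shift_letter ?size_tuple //; lia. Qed.

Lemma letter_shift_both x m i : 0 < i ->
  letter (shift_both x m) i =
    (letter x i + (if (i == t) || (i == n) then m else 0))%R.
Proof.
move=> i0; rewrite !letter_shift_letter //; last lia.
have [->|_] := eqVneq i t; first by rewrite (ltn_eqF tn) addr0.
by rewrite addr0.
Qed.

Lemma windowE x m l :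
  window t x m l = substr (shift_both x m) (t + 1 - l) (n - 1).
Proof.
by rewrite substr_shift_letter // size_shift_letter size_tuple; lia.
Qed.

Lemma window_catE x m l : 0 < l <= t ->
  window t x m l ++ [:: (letter x n + m)%R] =
    substr (shift_both x m) (t + 1 - l) n.
Proof.
move=> l0t; have nE : n = (n - 1).+1 by lia.
rewrite windowE cats1 [X in _ = substr _ _ X]nE.
rewrite substrS ?size_shift_both; [|lia..].
by rewrite -nE letter_shift_both ?eqxx ?orbT //; lia.
Qed.

Lemma has_period_window x m l : 0 < l <= t ->
  has_period (window t x m l) l =
    punctured_period n t (letter x) l && (letter x t + m == letter x (t + l))%R.
Proof.
move=> /andP[l0 lt]; rewrite windowE; have sz := size_shift_both x m.
have letterE i : 0 < i < n -> i != t -> letter (shift_both x m) i = letter x i.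
  by move=> i_n /negPf it; rewrite letter_shift_both ?it ?ifF ?addr0 //; lia.
have letter_tE : (letter x t + m)%R = letter (shift_both x m) t.
  by rewrite letter_shift_both // eqxx.
apply/(has_period_substrP l)/andP => [||[_ tln per]|]; [lia|lia|split|].
- apply/punctured_periodP; split=> // [|i il it]; first lia.
  by rewrite -!letterE ?(per i) //; lia.
- by apply/eqP; rewrite letter_tE (per t) ?letterE //; lia.
- move=> [/punctured_periodP[_ _ tln per] /eqP xtE].
  split=> // [|i ti il]; first lia.
  have [->|it] := eqVneq i t; first by rewrite -letter_tE xtE letterE //; lia.
  by rewrite !letterE ?(per i) //; lia.
Qed.

Lemma periodic_window_punctured x m l : 0 < l <= t ->
  periodic l (window t x m l) -> punctured_period n t (letter x) l.
Proof. by move=> lt /andP[]; rewrite has_period_window // => /andP[]. Qed.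

Lemma exists_periodic_window x l : punctured_period n t (letter x) l ->
  exists m, exists2 k, 0 < k <= t & periodic k (window t x m k).
Proof.
move=> xl; have ex : exists k, punctured_period n t (letter x) k by exists l.
case: (ex_minnP ex) => k xk mink {l xl ex}.
have /punctured_periodP[k0 kt tkn _] := xk.
exists (letter x (t + k)%N - letter x t)%R, k; first by rewrite k0.
set m := (_ - _)%R; have perk : has_period (window t x m k) k.
  by rewrite has_period_window ?k0 // xk addrC subrK eqxx.
rewrite /periodic perk; apply/forallP => -[j /= jk]; apply/negP => perj.
have j0 : 0 < j by case/and3P: perj.
suff /mink : punctured_period n t (letter x) j by lia.
have : has_period (window t x m j) j.
  move: perj; rewrite !windowE.
  by apply: has_period_substrW; rewrite ?size_shift_both; lia.
by rewrite has_period_window; [case/andP|lia].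
Qed.

Lemma periodic_window_cat x m l : 0 < l <= t -> periodic l (window t x m l) ->
  periodic l (window t x m l ++ [:: (letter x n + m)%R]) =
    (letter x n - letter x t == offset_of x)%R.
Proof.
move=> l0t pl; have /andP[l0 lt] := l0t.
have xl := periodic_window_punctured l0t pl.
have /punctured_periodP[_ _ tln _] := xl.
have /andP[_ /eqP xtE] : punctured_period n t (letter x) l &&
    (letter x t + m == letter x (t + l))%R.
  by rewrite -has_period_window //; case/andP: pl.
have nE : n = (n - 1).+1 by lia.
have letter_nE : letter (shift_both x m) n = (letter x n + m)%R.
  by rewrite letter_shift_both ?eqxx ?orbT //; lia.
have letter_nlE : letter (shift_both x m) (n - l) = letter x (n - l).
  by rewrite letter_shift_both ?ifF ?addr0 //; lia.
have per_substr : periodic l (substr (shift_both x m) (t + 1 - l) (n - 1)).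
  by rewrite -windowE.
have := periodic_substrS _ _ per_substr; rewrite -nE size_shift_both.
rewrite window_catE // letter_nE letter_nlE => ->; [|lia..].
by rewrite (offsetE xl) -xtE [RHS]eq_sym subr_eq addrA subrK eq_sym.
Qed.

Lemma in_codeE x :
  (x \in code d n t) = (letter x n - letter x t != offset_of x)%R.
Proof.
have ord_bounds (j : 'I_t.+1) : 1 <= j -> 0 < j <= t by have := ltn_ord j; lia.
rewrite !inE; case: (offsetP n t (letter x)) => [l xl|no].
  have [m [k /andP[k0 kt] pk]] := exists_periodic_window xl.
  have kt1 : k < t.+1 by [].
  rewrite -(offsetE xl); apply/orP/idP => [[/existsP[m' /existsP[j]]|]|xnt].
  - by case/and3P => /ord_bounds j0t pj; rewrite periodic_window_cat.
  - by case/andP => _ /forallP/(_ m)/forallP/(_ (Ordinal kt1)); rewrite k0 pk.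
  - left; apply/existsP; exists m; apply/existsP; exists (Ordinal kt1).
    by rewrite /= k0 pk periodic_window_cat ?k0.
have nper m (j : 'I_t.+1) : 1 <= j -> ~~ periodic j (window t x m j).
  move/ord_bounds => j0t.
  exact: contra (periodic_window_punctured j0t) (no j).
rewrite subr_eq0 [in RHS]eq_sym.
apply/orP/idP => [[/existsP[m /existsP[j]]|]|xnt].
- by case/and3P => /nper/negPf->.
- by case/andP.
- by right; rewrite xnt; do 2![apply/forallP => ?]; apply/implyP/nper.
Qed.

End Membership.

Section Digraph.
Variables (V : finType) (e : rel V).
Implicit Types (t k : nat) (S : {set V}).

Lemma has_walk0 u v : has_walk e 0 u v = (u == v).
Proof.
by apply/existsP/idP => [[p]|uv]; [rewrite (tuple0 p)|exists [tuple]].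
Qed.

Lemma has_walkS k u v :
  has_walk e k.+1 u v = [exists w, e u w && has_walk e k w v].
Proof.
apply/existsP/existsP => [[/tupleP[w p]]|[w /andP[uw /existsP[p wpv]]]].
  rewrite /= -andbA => /andP[uw wpv].
  by exists w; rewrite uw; apply/existsP; exists p.
by exists [tuple of w :: p]; rewrite /= uw.
Qed.

Lemma has_walk1 u v : has_walk e 1 u v = e u v.
Proof.
rewrite has_walkS; apply/existsP/idP => [[w]|uv].
  by rewrite has_walk0 => /andP[uw /eqP<-].
by exists v; rewrite uv has_walk0 /=.
Qed.

Lemma in_ballP t u v :
  reflect (exists2 k, k <= t & has_walk e k u v) (u \in in_ball e t v).
Proof.
rewrite inE; apply: (iffP existsP) => [[k /andP[uv _]]|[k kt uv]].
  by exists k => //; rewrite -ltnS.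
have ex : exists k, has_walk e k u v by exists k.
case: (ex_minnP ex) => j uvj minj.
have jt : j < t.+1 by rewrite ltnS (leq_trans _ kt) ?minj.
exists (Ordinal jt); rewrite /is_dist uvj.
by apply/forallP => i; apply/negP => /minj; rewrite leqNgt ltn_ord.
Qed.

Lemma has_walk_twin u v k x : e^~ u =1 e^~ v ->
  has_walk e k.+1 x u = has_walk e k.+1 x v.
Proof.
move=> uv; elim: k x => [|k IH] x; first by rewrite !has_walk1; apply: uv.
by rewrite has_walkS [RHS]has_walkS; apply: eq_existsb => w; rewrite IH.
Qed.

Lemma eq_ID_ball t S u v x : ID e t S u = ID e t S v -> x \in S ->
  (x \in in_ball e t u) = (x \in in_ball e t v).
Proof. by move=> /setP/(_ x); rewrite !in_setI => + xS; rewrite xS !andbT. Qed.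

(* Twins have the same in-balls except for the twins themselves. *)
Lemma identifying_code_twin t S u v :
    identifying_code e t S -> e^~ u =1 e^~ v -> u \notin S -> v \notin S ->
  u = v.
Proof.
move=> [_ sepS] uv uS vS; apply/eqP/contraT => /eqP/sepS[].
apply/setP => x; rewrite !in_setI; have [xS|_] := boolP (x \in S); last first.
  by rewrite !andbF.
have [xu xv] : x == u = false /\ x == v = false.
  by split; apply: contraTF xS => /eqP->.
rewrite !andbT; apply/in_ballP/in_ballP => -[[|k] kt];
  rewrite ?has_walk0 ?xu ?xv //.
  by rewrite (has_walk_twin _ _ uv); exists k.+1.
by rewrite -(has_walk_twin _ _ uv); exists k.+1.
Qed.

End Digraph.

Section DeBruijn.
Variables (d n : nat).
Implicit Types u v x : n.-tuple 'Z_d.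

Definition string_of m (g : nat -> 'Z_d) : m.-tuple 'Z_d :=
  [tuple g i.+1 | i < m].

Lemma letter_string_of m g i : 0 < i <= m -> letter (string_of m g) i = g i.
Proof.
case: i => // i im.
by rewrite /letter -[i.+1.-1]/(val (Ordinal im)) -tnth_nth tnth_mktuple.
Qed.

Lemma eq_from_letter m (p q : m.-tuple 'Z_d) :
  (forall i, 0 < i <= m -> letter p i = letter q i) -> p = q.
Proof.
move=> pq; apply/val_inj/(@eq_from_nth _ 0%R); first by rewrite !size_tuple.
by move=> i; rewrite size_tuple => /(pq i.+1).
Qed.

Lemma first_diff u v : u <> v ->
  exists D, [/\ 0 < D <= n, forall i, 0 < i < D -> letter u i = letter v i
            & letter u D <> letter v D].
Proof.
move=> uv; have [|no_diff] :=
    boolP [exists i : 'I_n, letter u i.+1 != letter v i.+1]; last first.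
  case: uv; apply: eq_from_letter => -[//|i] i_n; apply/eqP.
  by have := existsPn no_diff (Ordinal (i_n : i < n)); rewrite negbK.
case/existsP => i0 ui0.
have ex : exists D, (0 < D <= n) && (letter u D != letter v D).
  by exists i0.+1; rewrite ltn_ord.
case: (ex_minnP ex) => D /andP[D_n /eqP uvD] minD; exists D; split=> // i iD.
by apply/eqP/contraT => ui; have := minD i; rewrite ui; lia.
Qed.

Lemma deBruijnP u v :
  reflect (forall i, 0 < i < n -> letter u i.+1 = letter v i) (deBruijn u v).
Proof.
have size_substr_u : size (substr u 2 n) = n - 1.
  by rewrite size_substr ?size_tuple.
have size_substr_v : size (substr v 1 (n - 1)) = n - 1.
  by rewrite size_substr ?size_tuple; lia.
apply: (iffP eqP) => [uv [//|i] i_n|uv].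
  have := congr1 (nth 0%R ^~ i) uv; rewrite /= !nth_substr; [|lia..].
  by rewrite add2n add1n.
apply: (@eq_from_nth _ 0%R) => [|i]; first by rewrite size_substr_u.
by rewrite size_substr_u => i_n; rewrite !nth_substr ?uv //; lia.
Qed.

Lemma deBruijn_walkP k u v :
  reflect (forall i, 0 < i -> i + k <= n -> letter u (i + k) = letter v i)
          (has_walk (@deBruijn d n) k u v).
Proof.
elim: k u => [|k IH] u.
  rewrite has_walk0; apply: (iffP eqP) => [-> i|uv]; first by rewrite addn0.
  apply: eq_from_letter => i /andP[i0 i_n].
  by have := uv i; rewrite addn0; apply.
rewrite has_walkS; apply: (iffP existsP).
  move=> [w /andP[/deBruijnP uw /IH wv]] i i0 ik.
  by rewrite addnS uw ?wv //; lia.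
move=> uv; pose next i := if i == n then letter v (n - k) else letter u i.+1.
exists (string_of n next); apply/andP; split.
  apply/deBruijnP => i i_n; rewrite letter_string_of /next; last lia.
  by case: eqP => //; lia.
apply/IH => i i0 ik; rewrite letter_string_of /next; last lia.
case: eqP => [ikn|ikn]; first by congr letter; lia.
by rewrite -uv ?addnS //; lia.
Qed.

Lemma in_ball_letterP t u v :
  reflect (exists2 k, k <= t &
             forall i, 0 < i -> i + k <= n -> letter u (i + k) = letter v i)
          (u \in in_ball (@deBruijn d n) t v).
Proof.
by apply: (iffP (in_ballP _ _ _ _)) => -[k kt /deBruijn_walkP uv]; exists k.
Qed.

Definition prefix_of u : n.-1.-tuple 'Z_d := string_of n.-1 (letter u).

Lemma eq_prefix_of u v :
  prefix_of u = prefix_of v <->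
  (forall i, 0 < i < n -> letter u i = letter v i).
Proof.
split=> [uv i i_n|uv].
  have := congr1 (fun p : n.-1.-tuple 'Z_d => letter p i) uv.
  by rewrite /= !letter_string_of //; lia.
by apply: eq_from_letter => i i_n; rewrite !letter_string_of // uv //; lia.
Qed.

Lemma identifying_code_prefix_inj t (C : {set n.-tuple 'Z_d}) :
  identifying_code (@deBruijn d n) t C -> {in ~: C &, injective prefix_of}.
Proof.
move=> idC u v; rewrite !inE => uC vC /eq_prefix_of uv.
apply: (identifying_code_twin idC) => // x.
by apply/deBruijnP/deBruijnP => xuv i i_n; rewrite xuv ?uv.
Qed.

End DeBruijn.

Section Prepend.
Variable T : Type.
Implicit Types w z : nat -> T.

Definition prepend (s : nat) w z (i : nat) : T :=
  if i <= s then w i else z (i - s).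

Lemma prepend_left s w z i : i <= s -> prepend s w z i = w i.
Proof. by rewrite /prepend => ->. Qed.

Lemma prepend_right s w z i : 0 < i -> prepend s w z (i + s) = z i.
Proof.
by move=> i0; rewrite /prepend leqNgt -{1}[s]add0n ltn_add2r i0 addnK.
Qed.

End Prepend.

Lemma addr1_neq (R : nzRingType) (a : R) : (a + 1 != a)%R.
Proof. by rewrite -subr_eq0 addrAC subrr add0r oner_neq0. Qed.

Section Separation.
Variables (d t n : nat).
Hypotheses (t0 : 0 < t) (tn : 2 * t <= n).
Implicit Types (u v x : n.-tuple 'Z_d) (w z : nat -> 'Z_d).

Local Notation ball := (in_ball (@deBruijn d n) t).
Local Notation S := (code d n t).
Local Notation ID_S := (ID (@deBruijn d n) t S).

Lemma in_code_string_of z :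
  (string_of n z \in S) = (z n - z t != offset n t z)%R.
Proof.
rewrite in_codeE ?letter_string_of; try lia.
congr (_ != _); apply: eq_offset => i i_n _.
by rewrite letter_string_of //; lia.
Qed.

Lemma last_neq_in_code u v :
    (forall i, 0 < i < n -> letter u i = letter v i) ->
    letter u n != letter v n ->
  (u \in S) || (v \in S).
Proof.
move=> uv; apply: contraR; rewrite negb_or !in_codeE ?negbK; [|lia..].
rewrite (@eq_offset _ _ _ _ (letter v)) => [|i i_n _]; last exact: uv.
rewrite (uv t); last lia.
case/andP => /eqP uE /eqP vE.
by apply/eqP/(addIr (- letter v t)%R); rewrite uE vE.
Qed.

Lemma exists_codeword_prepend w z :
  exists a, string_of n (prepend t [eta w with t |-> a] z) \in S.
Proof.
pose g := prepend t w z; exists (g n - offset n t g + 1)%R.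
rewrite in_code_string_of (@eq_offset _ _ _ _ g) => [|i _ /negPf it].
  have gnE a : prepend t [eta w with t |-> a] z n = g n.
    by rewrite /g /prepend; case: ifP => //; lia.
  by rewrite gnE prepend_left //= eqxx subr_eq addrC -subr_eq eq_sym addr1_neq.
by rewrite /g /prepend /= it.
Qed.

Lemma in_ball_prepend s w v : s <= t ->
  string_of n (prepend s w (letter v)) \in ball v.
Proof.
move=> st; apply/in_ball_letterP; exists s => // i i0 i_n.
by rewrite letter_string_of ?prepend_right //; lia.
Qed.

Lemma code_dominating v : exists2 x, x \in S & x \in ball v.
Proof.
have [a aS] := exists_codeword_prepend (fun=> 0%R) (letter v).
by eexists; [apply: aS|apply: in_ball_prepend].
Qed.

(* A walk from [x] to [v] of length [k > n - D] would give [x(t+1-p : n)] the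
   period [p = k - (n - D)], which [offset_period] excludes for a codeword; one
   of length [k < n - D] would put [v_1] among the first [n - D] letters of
   [x]. *)
Lemma near_codeword_notin_ball u v D c :
    0 < D <= n -> n < D + t ->
    (forall i, 0 < i < D -> letter u i = letter v i) ->
    letter u D <> letter v D -> c <> letter v 1 ->
  let x := string_of n (prepend (n - D) (fun=> c) (letter u)) in
  x \in S -> x \notin ball v.
Proof.
move=> D_n Dt uv uvD cv x; rewrite in_codeE; [move/eqP=> xS|lia..].
have xu i : 0 < i <= D -> letter x (i + (n - D)) = letter u i.
  by move=> iD; rewrite letter_string_of ?prepend_right //; lia.
apply/negP => /in_ball_letterP[k kt xv].
have [kD|Dk|kD] := ltngtP k (n - D).
- apply: cv; rewrite -(xv 1) //; last lia.
  by rewrite letter_string_of ?prepend_left //; lia.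
- apply: xS; rewrite (@offset_period _ _ _ _ (k - (n - D))) //; first lia.
  move=> i it i_n; have -> : i + (k - (n - D)) = i - (n - D) + k by lia.
  have -> : letter x i = letter u (i - (n - D)) by rewrite -xu ?subnK //; lia.
  by rewrite xv ?uv //; lia.
- by apply: uvD; rewrite -xu; [rewrite -kD xv //|]; lia.
Qed.

Lemma ID_neq_near u v D :
    0 < D <= n -> n < D + t ->
    (forall i, 0 < i < D -> letter u i = letter v i) ->
    letter u D <> letter v D ->
  ID_S u <> ID_S v.
Proof.
move=> D_n Dt uv uvD /eq_ID_ball eqB.
pose c : 'Z_d := (letter v 1 + 1)%R.
have cv : c <> letter v 1 by apply/eqP/addr1_neq.
have cu : c <> letter u 1 by rewrite uv //; lia.
pose x z := string_of n (prepend (n - D) (fun=> c) z).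
have x_ball (y : n.-tuple 'Z_d) : x (letter y) \in ball y.
  by apply: in_ball_prepend; lia.
have xD z : letter (x z) n = z D.
  by rewrite letter_string_of /prepend ?ifF ?subKn //; lia.
have : (x (letter u) \in S) || (x (letter v) \in S).
  apply: last_neq_in_code => [i i_n|]; last by rewrite !xD; apply/eqP.
  rewrite !letter_string_of /prepend; [|lia..].
  by case: leqP => // Di; apply: uv; lia.
case/orP => xS.
  have /negP[] : x (letter u) \notin ball v.
    exact: (near_codeword_notin_ball D_n Dt uv uvD cv xS).
  by rewrite -eqB.
have /negP[] : x (letter v) \notin ball u.
  have vu i : 0 < i < D -> letter v i = letter u i by move/uv.
  exact: (near_codeword_notin_ball D_n Dt vu (nesym uvD) cu xS).
by rewrite eqB.
Qed.

(* A walk to [v] of length [k < t - 1] would make [w_(k+1)] equal to [v_1]; the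
   two alternatives are walks of length [t] and [t - 1]. *)
Lemma in_ball_prepend_t u v w :
    (forall i, 0 < i < t -> w i <> letter v 1) ->
    string_of n (prepend t w (letter u)) \in ball v ->
  (forall i, 0 < i <= n - t -> letter u i = letter v i) \/
  (w t = letter v 1 /\ forall i, 0 < i <= n - t -> letter u i = letter v i.+1).
Proof.
set x := string_of _ _ => wv /in_ball_letterP[k kt xv].
have xw i : 0 < i <= t -> letter x i = w i.
  by move=> it; rewrite letter_string_of ?prepend_left //; lia.
have xu i : 0 < i <= n - t -> letter x (i + t) = letter u i.
  by move=> i_n; rewrite letter_string_of ?prepend_right //; lia.
have [ktE|kt_neq] := eqVneq k t.
  by left=> i i_n; rewrite -xu // -ktE xv //; lia.
have [ktE|kt1] := eqVneq (1 + k) t; last first.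
  by case: (wv (1 + k)); [lia|rewrite -xw ?xv //; lia].
right; split=> [|i i_n]; first by rewrite -ktE -xw ?xv //; lia.
by rewrite -xu // -ktE addnA addn1 xv //; lia.
Qed.

Lemma ID_eq_far_shift u v D :
    0 < D <= n - t -> letter u D <> letter v D ->
    ID_S u = ID_S v ->
  forall i, 0 < i <= n - t -> letter u i = letter v i.+1.
Proof.
move=> D_nt uvD /eq_ID_ball eqB; pose c : 'Z_d := (letter v 1 + 1)%R.
have [a xS] := exists_codeword_prepend (fun=> c) (letter u).
have := in_ball_prepend [eta fun=> c with t |-> a] u (leqnn t); rewrite eqB //.
case/in_ball_prepend_t => [i it /=|uv|[]] //; last by case: uvD; apply: uv.
by rewrite ltn_eqF; [apply/eqP/addr1_neq|lia].
Qed.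

Lemma alternating_in_code z c : 1 < t -> t + 2 < n ->
    period_between z 1 (n - t) 2 -> c != z 2 ->
  string_of n (prepend t [eta fun=> z 1 with t |-> c] z) \in S.
Proof.
move=> t1 t2n zz cz; set g := prepend _ _ _.
have gt : g t = c by rewrite /g prepend_left //= eqxx.
have gr i : 0 < i -> g (i + t) = z i by exact: prepend_right.
have g_per i : t < i -> i + 2 <= n -> g i = g (i + 2).
  move=> ti i_n; have -> : i + 2 = i - t + 2 + t by lia.
  have {1}-> : i = i - t + t by lia.
  by rewrite !gr ?(zz (i - t)) //; lia.
have g2 : punctured_period n t g 2.
  apply/punctured_periodP; split=> // i i_n it.
  have [ti|it'] := ltnP t i; first by apply: g_per; lia.
  have -> : i + 2 = 1 + t by lia.
  by rewrite gr // /g prepend_left //= (negPf it).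
rewrite in_code_string_of (offsetE g2) gt addnC gr // (g_per (n - 2)); [|lia..].
by rewrite subnK ?(inj_eq (addrI _)) ?eqr_opp //; lia.
Qed.

Lemma ID_eq_far_letter1_neq u v D :
    0 < D <= n - t -> letter u D <> letter v D ->
    ID_S u = ID_S v ->
  letter u 1 <> letter v 1.
Proof.
move=> D_nt uvD eqID uv1; case: (uvD).
have uv := ID_eq_far_shift D_nt uvD eqID.
have vu := ID_eq_far_shift D_nt (nesym uvD) (esym eqID).
case: D D_nt {uvD} => // D; elim: D => // D IH D_nt.
by rewrite -(vu D.+1) -?(uv D.+1) ?IH //; lia.
Qed.

Lemma ID_neq_far u v D : 1 < t -> t + 2 < n ->
    0 < D <= n - t -> letter u D <> letter v D ->
  ID_S u <> ID_S v.
Proof.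
move=> t1 t2n D_nt uvD eqID.
have uv := ID_eq_far_shift D_nt uvD eqID.
have vu := ID_eq_far_shift D_nt (nesym uvD) (esym eqID).
have uv1 := ID_eq_far_letter1_neq D_nt uvD eqID.
pose c : 'Z_d := (letter v 1 + 1)%R.
have cv : c != letter v 1 by exact: addr1_neq.
pose w := [eta fun=> letter u 1 with t |-> c].
pose x := string_of n (prepend t w (letter u)).
have xS : x \in S.
  apply: alternating_in_code => // [i i0 i_n|]; last by rewrite -vu //; lia.
  by rewrite uv ?vu ?addn2 //; lia.
have : x \in ball u by exact: in_ball_prepend.
rewrite (eq_ID_ball eqID) // => /in_ball_prepend_t[i it /=|uvE|[]].
- by rewrite ltn_eqF //; lia.
- by apply/uvD/uvE.
- by rewrite /= eqxx => /eqP; rewrite (negPf cv).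
Qed.

Lemma identifying_code_code : 1 < t -> t + 2 < n ->
  identifying_code (@deBruijn d n) t S.
Proof.
move=> t1 t2n; split=> [v|u v uv].
  have [x xS xv] := code_dominating v.
  by move/setP/(_ x); rewrite in_setI xS xv in_set0.
have [D [D_n eq_uv uvD]] := first_diff uv.
have [Dt|Dt] := ltnP n (D + t); first exact: (ID_neq_near D_n Dt eq_uv uvD).
by apply: (ID_neq_far t1 t2n _ uvD); lia.
Qed.

Lemma prefix_inj_setC_code : {in ~: S &, injective (@prefix_of d n)}.
Proof.
move=> u v; rewrite in_setC => uS; rewrite in_setC => vS /eq_prefix_of uv.
apply: eq_from_letter => i /andP[i0]; rewrite leq_eqVlt => /predU1P[->|i_n].
  apply/eqP/contraT => /(last_neq_in_code uv).
  by rewrite (negPf uS) (negPf vS).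
by apply: uv; rewrite i0.
Qed.

Lemma prefix_surj_setC_code p : exists2 u, u \in ~: S & prefix_of u = p.
Proof.
pose g := [eta letter p with n |-> (letter p t + offset n t (letter p))%R].
have gp i : 0 < i < n -> g i = letter p i.
  by move=> i_n /=; rewrite ltn_eqF //; lia.
exists (string_of n g).
  rewrite in_setC in_code_string_of negbK (eq_offset (Y := letter p)).
    by rewrite (gp t) /g /= ?eqxx ?[(letter p t + _)%R]addrC ?addrK //; lia.
  by move=> i i_n _; apply: gp.
apply: eq_from_letter => i i_n.
by rewrite !letter_string_of ?gp //; lia.
Qed.

End Separation.

Lemma card_words d m : 1 < d -> #|{: m.-tuple 'Z_d}| = d ^ m.
Proof. by move=> d1; rewrite card_tuple card_ord Zp_cast. Qed.

Lemma leq_card_setC_identifying_code (d t n : nat) (C : {set n.-tuple 'Z_d}) :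
  1 < d -> identifying_code (@deBruijn d n) t C -> #|~: C| <= d ^ n.-1.
Proof.
by move=> d1 /identifying_code_prefix_inj/leq_card_in; rewrite card_words.
Qed.

Lemma card_setC_code (d t n : nat) :
  1 < d -> 0 < t -> 2 * t <= n -> #|~: code d n t| = d ^ n.-1.
Proof.
move=> d1 t0 tn; rewrite -(card_in_imset (prefix_inj_setC_code t0 tn)).
rewrite -card_words //; apply: eq_card => p; rewrite inE; apply/imsetP.
by have [u uS <-] := prefix_surj_setC_code t0 tn p; exists u.
Qed.

Theorem theorem3p9 (d t n : nat) (hd : 2 <= d) (ht : 2 <= t) (hn : 5 <= n)
    (hnt : 2 * t <= n) :
  [/\ identifying_code (@deBruijn d n) t (code d n t),
      #|code d n t| = d ^ (n - 1) * (d - 1)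
    & forall C : {set n.-tuple 'Z_d},
        identifying_code (@deBruijn d n) t C -> #|code d n t| <= #|C|].
Proof.
have t0 : 0 < t by exact: ltnW.
have cardSC := card_setC_code hd t0 hnt.
split=> [||C /(leq_card_setC_identifying_code hd) cardC].
- by apply: identifying_code_code => //; lia.
- have := cardsC (code d n t).
  rewrite cardSC card_words // mulnBr muln1 subn1 -expnSr prednK; lia.
- by have := cardsC C; have := cardsC (code d n t); rewrite cardSC; lia.
Qed.
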